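(* Let $\delta\ge 0$ be a fixed relative offset, and let $s_\delta=(s_{\delta,k})_{k=1}^r$, $q_{\delta,k}$, $q_\delta^c$, $z_\delta^c$, $K_\delta$, $\kappa_{\delta,k}$, $D_\delta(s_\delta)$, $C_{\mathrm{off},\delta}(s_\delta)$, $c_{\mathrm{eff},\delta}$ and $r_2(s_\delta)$ be as defined in the context. Suppose that $\operatorname{Var}(z_\delta^c\mid\delta)>0$, that $K_\delta\preceq\Lambda_\delta I$ for some real $\Lambda_\delta>0$, and that $c_{\mathrm{eff},\delta}>0$. If for some real $\eta_\delta$ with $0\le\eta_\delta<1$ $$C_{\mathrm{off},\delta}(s_\delta)\ \ge\ -\eta_\delta\,D_\delta(s_\delta),$$ then $$\operatorname{Kurt}(z_\delta^c\mid\delta)\ \ge\ 3+\frac{(1-\eta_\delta)\,c_{\mathrm{eff},\delta}}{\Lambda_\delta^2\,r_2(s_\delta)}.$$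
   Context: Setting (one attention head). $W_Q,W_K\in\mathbb{R}^{d\times d_h}$ are fixed matrices, and $R_i\in\mathbb{R}^{d_h\times d_h}$ are (orthogonal) rotary position matrices with $R_iR_j^\top=R_{i-j}$. For a fixed offset $\delta=i-j\ge0$, let $A_\delta=W_QR_\delta W_K^\top$. The token vectors $(x_i,x_j)\in\mathbb{R}^d\times\mathbb{R}^d$ are random, with a fixed joint law, the conditional activation law given offset $\delta$; all expectations, variances, covariances and cumulants written ''$\mid\delta$'' are under this law. The pre-softmax logit is $z_\delta=x_i^\top A_\delta x_j/\sqrt{d_h}$. Let $A_\delta/\sqrt{d_h}=U_\delta\operatorname{diag}(s_\delta)V_\delta^\top$ be a singular value decomposition (the factor $d_h^{-1/2}$ is absorbed into $s_\delta$), with singular values $s_{\delta,k}\ge0$ and left/right singular vectors $u_{\delta,k},v_{\delta,k}$, $k=1,\dots,r$. Put $$q_{\delta,k}=(x_i^\top u_{\delta,k})(x_j^\top v_{\delta,k}),\quad q_{\delta,k}^c=q_{\delta,k}-\mathbb{E}[q_{\delta,k}\mid\delta],\quad z_\delta^c=\sum_k s_{\delta,k}q_{\delta,k}^c .$$ The $q_{\delta,k}$ are assumed to have finite fourth moments. No independence between coordinates is assumed. Definitions. $K_\delta=\operatorname{Cov}(q_\delta^c\mid\delta)$ is the $r\times r$ covariance matrix of $q_\delta^c=(q_{\delta,k}^c)_k$; $\preceq$ is the Loewner order. $\operatorname{cum}(\cdot,\cdot,\cdot,\cdot\mid\delta)$ is the joint fourth cumulant: for variables $a,b,c,e$ with centered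 versions $\bar a,\bar b,\bar c,\bar e$, $\operatorname{cum}(a,b,c,e)=\mathbb{E}[\bar a\bar b\bar c\bar e]-\mathbb{E}[\bar a\bar b]\mathbb{E}[\bar c\bar e]-\mathbb{E}[\bar a\bar c]\mathbb{E}[\bar b\bar e]-\mathbb{E}[\bar a\bar e]\mathbb{E}[\bar b\bar c]$. Set $\kappa_{\delta,k}=\operatorname{cum}(q_{\delta,k},q_{\delta,k},q_{\delta,k},q_{\delta,k}\mid\delta)$ (any sign allowed) and $$D_\delta(s_\delta)=\sum_k\kappa_{\delta,k}s_{\delta,k}^4,\qquad c_{\mathrm{eff},\delta}=\frac{D_\delta(s_\delta)}{\sum_k s_{\delta,k}^4},\qquad r_2(s_\delta)=\frac{\left(\sum_k s_{\delta,k}^2\right)^2}{\sum_k s_{\delta,k}^4},$$ $$C_{\mathrm{off},\delta}(s_\delta)=\sum_{\substack{k,\ell,m,n\\ \text{not all equal}}}s_{\delta,k}s_{\delta,\ell}s_{\delta,m}s_{\delta,n}\operatorname{cum}(q_{\delta,k},q_{\delta,\ell},q_{\delta,m},q_{\delta,n}\mid\delta).$$ For a scalar random variable $z$ with positive variance, $\operatorname{Kurt}(z)=\mathbb{E}[(z-\mathbb{E}z)^4]/\operatorname{Var}(z)^2$ (non-excess kurtosis). *)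

(* Defs.v *)
From mathcomp Require Import all_boot all_order all_algebra.
From mathcomp Require Import all_classical all_reals all_analysis.

Set Implicit Arguments.
Unset Strict Implicit.
Unset Printing Implicit Defensive.

Import Order.TTheory GRing.Theory Num.Theory.
Local Open Scope ring_scope.

Definition rotary (R : realType) (dh : nat) (Rot : int -> 'M[R]_dh) : Prop :=
  (forall i, Rot i *m (Rot i)^T = 1%:M) /\
  (forall i j, Rot i *m (Rot j)^T = Rot (i - j)).

Definition attn_mx (R : realType) (d dh : nat) (WQ WK : 'M[R]_(d, dh))
    (Rot : int -> 'M[R]_dh) (delta : nat) : 'M[R]_d :=
  WQ *m Rot delta%:Z *m WK^T.

(* U and V are rectangular with r orthonormal columns, and zero singular
   values are allowed: the compact SVD (r the rank) and the full SVD (r = d)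
   are both instances.  The singular values need not be sorted. *)
Definition is_svd (R : realType) (d r : nat) (A : 'M[R]_d)
    (U : 'M[R]_(d, r)) (s : 'rV[R]_r) (V : 'M[R]_(d, r)) : Prop :=
  [/\ U^T *m U = 1%:M, V^T *m V = 1%:M, (forall k, 0 <= s 0 k)
    & A = U *m diag_mx s *m V^T].

Definition loewner_le (R : realType) (n : nat) (A B : 'M[R]_n) : Prop :=
  (B - A)^T = B - A /\
  forall v : 'cV[R]_n, 0 <= (v^T *m (B - A) *m v) 0 0.

Definition measurable_vec (disp : measure_display) (T : measurableType disp)
    (R : realType) (d : nat) (x : T -> 'cV[R]_d) : Prop :=
  forall a : 'I_d, measurable_fun [set: T] (fun w => x w a 0).

Definition mode_prod (T : Type) (R : realType) (d r : nat)
    (x y : T -> 'cV[R]_d) (U V : 'M[R]_(d, r)) (k : 'I_r) : T -> R :=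
  fun w => ((x w)^T *m col k U) 0 0 * ((y w)^T *m col k V) 0 0.

(* [fine] sends an infinite expectation to 0; every expectation below is
   finite as soon as the variables involved have finite fourth moments. *)
Definition mean (disp : measure_display) (T : measurableType disp)
    (R : realType) (P : probability T R) (X : T -> R) : R :=
  fine ('E_P[X])%E.

Definition centered (disp : measure_display) (T : measurableType disp)
    (R : realType) (P : probability T R) (X : T -> R) : T -> R :=
  fun w => X w - mean P X.

Definition cov_mx (disp : measure_display) (T : measurableType disp)
    (R : realType) (P : probability T R) (r : nat) (q : 'I_r -> T -> R)
    : 'M[R]_r :=
  \matrix_(k, l) fine (covariance P (q k) (q l)).

Definition cum4 (disp : measure_display) (T : measurableType disp)
    (R : realType) (P : probability T R) (a b c e : T -> R) : R :=
  let a' := centered P a in let b' := centered P b in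
  let c' := centered P c in let e' := centered P e in
  mean P (fun w => a' w * b' w * c' w * e' w)
  - mean P (fun w => a' w * b' w) * mean P (fun w => c' w * e' w)
  - mean P (fun w => a' w * c' w) * mean P (fun w => b' w * e' w)
  - mean P (fun w => a' w * e' w) * mean P (fun w => b' w * c' w).

(* Non-excess kurtosis, meaningful when the variance is positive. *)
Definition kurt (disp : measure_display) (T : measurableType disp)
    (R : realType) (P : probability T R) (z : T -> R) : R :=
  mean P (fun w => (z w - mean P z) ^+ 4) / fine ('V_P[z])%E ^+ 2.

Definition centered_logit (disp : measure_display) (T : measurableType disp)
    (R : realType) (P : probability T R) (r : nat) (s : 'rV[R]_r)
    (q : 'I_r -> T -> R) : T -> R :=
  fun w => \sum_k s 0 k * centered P (q k) w.

Definition diag_cum (disp : measure_display) (T : measurableType disp)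
    (R : realType) (P : probability T R) (r : nat) (s : 'rV[R]_r)
    (q : 'I_r -> T -> R) : R :=
  \sum_k cum4 P (q k) (q k) (q k) (q k) * s 0 k ^+ 4.

Definition off_cum (disp : measure_display) (T : measurableType disp)
    (R : realType) (P : probability T R) (r : nat) (s : 'rV[R]_r)
    (q : 'I_r -> T -> R) : R :=
  \sum_k \sum_l \sum_m \sum_(n | ~~ [&& k == l, l == m & m == n])
    s 0 k * s 0 l * s 0 m * s 0 n * cum4 P (q k) (q l) (q m) (q n).

Definition c_eff (disp : measure_display) (T : measurableType disp)
    (R : realType) (P : probability T R) (r : nat) (s : 'rV[R]_r)
    (q : 'I_r -> T -> R) : R :=
  diag_cum P s q / \sum_k s 0 k ^+ 4.

Definition r2 (R : realType) (r : nat) (s : 'rV[R]_r) : R :=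
  (\sum_k s 0 k ^+ 2) ^+ 2 / \sum_k s 0 k ^+ 4.

(* Main.v *)
(** The joint fourth cumulant is symmetric and multilinear, so the sum of
    [s_k s_l s_m s_n cum(q_k, q_l, q_m, q_n)] over all indices is the fourth
    cumulant [E z^4 - 3 (Var z)^2] of the logit [z].  Splitting this sum into its
    diagonal and off-diagonal parts gives [E z^4 - 3 (Var z)^2 = D + C_off], which
    is at least [(1 - eta) D] with [D > 0].  Dividing by
    [(Var z)^2 = (s^T K s)^2 <= (Lambda |s|^2)^2] yields the bound, because
    [c_eff / r_2 = D / |s|^4]. *)

Require Import Defs.
From mathcomp Require Import all_boot all_order all_algebra.
From mathcomp Require Import all_classical all_reals all_analysis.
From mathcomp Require Import measurable_realfun ring lra.
Import Order.TTheory GRing.Theory Num.Theory.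
Local Open Scope ring_scope.

(** * Integrability from finite fourth moments *)

(** Measurability of [X] is recorded separately, since that of [X ^+ 4] does not imply it. *)
Definition has_fourth_moment {disp : measure_display} {T : measurableType disp}
    {R : realType} (P : probability T R) (X : T -> R) : Prop :=
  measurable_fun setT X /\ P.-integrable setT (EFin \o (fun w => X w ^+ 4)).

(** Apply [2 |t u| <= t^2 + u^2] to [a b] and [c e], then to the pairs of squares. This gives even a
    quarter of the right-hand side. The bound serves to dominate products of four variables. *)
Lemma normM4_le {R : realDomainType} (a b c e : R) :
  `|a * b * c * e| <= a ^+ 4 + b ^+ 4 + c ^+ 4 + e ^+ 4.
Proof.
have sq (t u : R) : 2 * `|t * u| <= t ^+ 2 + u ^+ 2.
  rewrite normrM -(real_normK (num_real t)) -(real_normK (num_real u)).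
  have := sqr_ge0 (`|t| - `|u|); nra.
have e4 (t : R) : (t ^+ 2) ^+ 2 = t ^+ 4 by rewrite -exprM.
have n2 (t : R) : `|t| ^+ 2 = t ^+ 2 by rewrite real_normK ?num_real.
have h1 := sq (a * b) (c * e).
have h2 := sq (a ^+ 2) (b ^+ 2).
have h3 := sq (c ^+ 2) (e ^+ 2).
rewrite -!exprMn !e4 !ger0_norm ?sqr_ge0 // in h2 h3.
rewrite !mulrA in h1.
have p (t : R) : 0 <= t ^+ 4 by rewrite -e4 sqr_ge0.
have := p a; have := p b; have := p c; have := p e; lra.
Qed.

Lemma fourth_moment_integrableM4 {disp} {T : measurableType disp}
    {R : realType} {P : probability T R} {a b c e : T -> R} :
  has_fourth_moment P a -> has_fourth_moment P b -> has_fourth_moment P c ->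
  has_fourth_moment P e ->
  P.-integrable setT (EFin \o (fun w => a w * b w * c w * e w)).
Proof.
move=> [ma ia] [mb ib] [mc ic] [me ie].
have := integrableD measurableT (integrableD measurableT
  (integrableD measurableT ia ib) ic) ie.
apply: le_integrable => //.
  by apply/measurable_EFinP; do 3! apply: measurable_funM => //.
move=> w _ /=; rewrite lee_fin.
exact: le_trans (normM4_le _ _ _ _) (ler_norm _).
Qed.

Lemma fourth_moment_cst {disp} {T : measurableType disp} {R : realType}
    (P : probability T R) (a : R) : has_fourth_moment P (fun=> a).
Proof.
split; first exact: measurable_cst.
exact: (finite_measure_integrable_cst P (a ^+ 4)).
Qed.

Lemma fourth_momentZ {disp} {T : measurableType disp} {R : realType}
    (P : probability T R) (a : R) (X : T -> R) :
  has_fourth_moment P X -> has_fourth_moment P (fun w => a * X w).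
Proof.
move=> [mX iX]; split; first exact: measurable_funM.
have := integrableZl measurableT (a ^+ 4) iX.
by congr integrable; apply/funext => w /=; rewrite -EFinM exprMn.
Qed.

Lemma fourth_momentD {disp} {T : measurableType disp} {R : realType}
    (P : probability T R) (X Y : T -> R) :
  has_fourth_moment P X -> has_fourth_moment P Y ->
  has_fourth_moment P (fun w => X w + Y w).
Proof.
move=> [mX iX] [mY iY].
have mXY := measurable_funD mX mY; split=> //.
(* The constant 8 comes from using [(t + u)^2 <= 2 (t^2 + u^2)] twice, first on [X], [Y] and then on
   their squares. *)
have := integrableZl measurableT 8 (integrableD measurableT iX iY).
apply: le_integrable => //; first exact/measurable_EFinP/measurable_funX.
move=> w _ /=; rewrite lee_fin.
have e4 (t : R) : t ^+ 4 = (t ^+ 2) ^+ 2 by rewrite -exprM.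
apply: (le_trans _ (ler_norm _)); rewrite !e4 ger0_norm ?sqr_ge0 //.
have h (t u : R) : (t + u) ^+ 2 <= 2 * (t ^+ 2 + u ^+ 2).
  have := sqr_ge0 (t - u); nra.
have h1 := h (X w) (Y w); have h2 := h (X w ^+ 2) (Y w ^+ 2).
have h0 := sqr_ge0 (X w + Y w).
have : ((X w + Y w) ^+ 2) ^+ 2 <= (2 * (X w ^+ 2 + Y w ^+ 2)) ^+ 2.
  by rewrite ler_sqr // nnegrE (le_trans h0).
rewrite exprMn; lra.
Qed.

Lemma fourth_moment_lincomb {disp} {T : measurableType disp} {R : realType}
    (P : probability T R) (r : nat) (a : 'I_r -> R) (f : 'I_r -> T -> R) :
  (forall k, has_fourth_moment P (f k)) ->
  has_fourth_moment P (fun w => \sum_k a k * f k w).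
Proof.
move=> hf; elim: (index_enum _) => [|k l ih].
  rewrite (_ : (fun _ => _) = fun=> 0); first exact: fourth_moment_cst.
  by apply/funext => w; rewrite big_nil.
rewrite (_ : (fun _ => _) =
  fun w => a k * f k w + \sum_(i <- l) a i * f i w); last first.
  by apply/funext => w; rewrite big_cons.
by apply: fourth_momentD => //; apply: fourth_momentZ.
Qed.

Lemma fourth_moment_centered {disp} {T : measurableType disp} {R : realType}
    {P : probability T R} {X : T -> R} :
  has_fourth_moment P X -> has_fourth_moment P (centered P X).
Proof. by move=> hX; apply: fourth_momentD => //; apply: fourth_moment_cst. Qed.

(** Pad the product with two constant factors 1, which have a fourth moment because [P] is
    finite. *)
Lemma fourth_moment_integrableM2 {disp} {T : measurableType disp}
    {R : realType} {P : probability T R} {a b : T -> R} :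
  has_fourth_moment P a -> has_fourth_moment P b ->
  P.-integrable setT (EFin \o (fun w => a w * b w)).
Proof.
move=> ha hb; have h1 := fourth_moment_cst P 1.
have := fourth_moment_integrableM4 ha hb h1 h1.
by congr integrable; apply/funext => w /=; rewrite !mulr1.
Qed.

Lemma fourth_moment_integrable {disp} {T : measurableType disp}
    {R : realType} {P : probability T R} {a : T -> R} :
  has_fourth_moment P a -> P.-integrable setT (EFin \o a).
Proof.
move=> ha; have := fourth_moment_integrableM2 ha (fourth_moment_cst P 1).
by congr integrable; apply/funext => w /=; rewrite mulr1.
Qed.

(** * Linearity of the mean, and centering *)

Lemma meanE {disp} {T : measurableType disp} {R : realType}
    (P : probability T R) (X : T -> R) : mean P X = \int[P]_w X w.
Proof. by rewrite /mean unlock. Qed.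

Lemma mean_cst {disp} {T : measurableType disp} {R : realType}
    (P : probability T R) (a : R) : mean P (fun=> a) = a.
Proof.
rewrite meanE Rintegral_cst // -[RHS]mulr1; congr (_ * _).
by have /(congr1 fine) := probability_setT P.
Qed.

Lemma mean_lincomb {disp} {T : measurableType disp} {R : realType}
    (P : probability T R) (r : nat) (a : 'I_r -> R) (f : 'I_r -> T -> R) :
  (forall k, P.-integrable setT (EFin \o f k)) ->
  mean P (fun w => \sum_k a k * f k w) = \sum_k a k * mean P (f k).
Proof.
move=> hf.
have hZ k : P.-integrable setT (EFin \o (fun w => a k * f k w)).
  by have := integrableZl measurableT (a k) (hf k).
(* The induction carries integrability along with the formula, because additivity of the integral
   requires the tail sum to be integrable. *)
have ind l : P.-integrable setT (EFin \o (fun w => \sum_(k <- l) a k * f k w))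
    /\ mean P (fun w => \sum_(k <- l) a k * f k w) =
       \sum_(k <- l) a k * mean P (f k).
  elim: l => [|k l [ih1 ih2]].
    rewrite big_nil (_ : (fun _ => _) = fun=> 0); last first.
      by apply/funext => w; rewrite big_nil.
    by split; [exact: integrable0 | exact: mean_cst].
  rewrite big_cons (_ : (fun _ => _) =
    fun w => a k * f k w + \sum_(i <- l) a i * f i w); last first.
    by apply/funext => w; rewrite big_cons.
  split; first by have := integrableD measurableT (hZ k) ih1.
  by rewrite -ih2 !meanE RintegralD // RintegralZl.
exact: (ind _).2.
Qed.

Lemma mean_lincombM {disp} {T : measurableType disp} {R : realType}
    (P : probability T R) (r : nat) (a : 'I_r -> R) (f : 'I_r -> T -> R)
    (g : T -> R) :
  (forall k, P.-integrable setT (EFin \o (fun w => f k w * g w))) ->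
  mean P (fun w => (\sum_k a k * f k w) * g w) =
  \sum_k a k * mean P (fun w => f k w * g w).
Proof.
move=> hf; rewrite -mean_lincomb //; congr mean; apply/funext => w.
by rewrite mulr_suml; apply: eq_bigr => k _; rewrite mulrA.
Qed.

Lemma mean_centered {disp} {T : measurableType disp} {R : realType}
    (P : probability T R) (X : T -> R) :
  P.-integrable setT (EFin \o X) -> mean P (centered P X) = 0.
Proof.
move=> iX; rewrite meanE RintegralB //; last first.
  exact: finite_measure_integrable_cst.
by rewrite -!meanE mean_cst subrr.
Qed.

Lemma centered_id {disp} {T : measurableType disp} {R : realType}
    (P : probability T R) (X : T -> R) : mean P X = 0 -> centered P X = X.
Proof. by move=> X0; apply/funext => w; rewrite /centered X0 subr0. Qed.

Lemma centered_lincomb {disp} {T : measurableType disp} {R : realType}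
    (P : probability T R) (r : nat) (a : 'I_r -> R) (f : 'I_r -> T -> R) :
  (forall k, P.-integrable setT (EFin \o f k)) ->
  centered P (fun w => \sum_k a k * f k w) =
  fun w => \sum_k a k * centered P (f k) w.
Proof.
move=> hf; apply/funext => w; rewrite /centered mean_lincomb // -sumrB.
by apply: eq_bigr => k _; rewrite mulrBr.
Qed.

(** * Multilinearity of the fourth cumulant *)

(** Centering commutes with linear combinations, and the first argument enters each of the four
    terms of the cumulant through exactly one mean, linearly. *)
Lemma cum4_lincomb {disp} {T : measurableType disp} {R : realType}
    (P : probability T R) (r : nat) (a : 'I_r -> R) (f : 'I_r -> T -> R)
    (b c e : T -> R) :
  (forall k, has_fourth_moment P (f k)) -> has_fourth_moment P b ->
  has_fourth_moment P c -> has_fourth_moment P e ->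
  cum4 P (fun w => \sum_k a k * f k w) b c e =
  \sum_k a k * cum4 P (f k) b c e.
Proof.
move=> hf /fourth_moment_centered hb /fourth_moment_centered hc
  /fourth_moment_centered he.
have hf' k := fourth_moment_centered (hf k).
rewrite /cum4 centered_lincomb; last by move=> k; exact: fourth_moment_integrable.
have E2 (g : T -> R) : has_fourth_moment P g ->
    mean P (fun w => (\sum_k a k * centered P (f k) w) * g w) =
    \sum_k a k * mean P (fun w => centered P (f k) w * g w).
  by move=> hg; apply: mean_lincombM => k; exact: fourth_moment_integrableM2.
have -> : mean P (fun w => (\sum_k a k * centered P (f k) w) *
      centered P b w * centered P c w * centered P e w) =
    \sum_k a k * mean P (fun w => centered P (f k) w * centered P b w *
      centered P c w * centered P e w).
  (* Grouping the last three factors into one makes [mean_lincombM] applicable. *)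
  have A k : (fun w => centered P (f k) w *
      (centered P b w * centered P c w * centered P e w)) =
      fun w => centered P (f k) w * centered P b w * centered P c w *
      centered P e w by apply/funext => w; rewrite !mulrA.
  under [RHS]eq_bigr do rewrite -A.
  rewrite -mean_lincombM; last first.
    by move=> k; rewrite A; exact: fourth_moment_integrableM4.
  by congr mean; apply/funext => w; rewrite !mulrA.
rewrite !E2 // !mulr_suml -!sumrB.
by apply: eq_bigr => k _; ring.
Qed.


(* Rotating the arguments lets multilinearity in the first slot act on all four. *)
Lemma cum4_rot {disp} {T : measurableType disp} {R : realType}
    (P : probability T R) (a b c e : T -> R) :
  cum4 P a b c e = cum4 P b c e a.
Proof.
have C (f g : T -> R) : mean P (fun w => f w * g w) = mean P (fun w => g w * f w).
  by congr mean; apply/funext => w; rewrite mulrC.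
rewrite /cum4 (C (centered P e) (centered P a)) (C (centered P c) (centered P a))
  (C (centered P b) (centered P a)).
rewrite (_ : mean P (fun w => centered P a w * centered P b w * centered P c w *
  centered P e w) = mean P (fun w => centered P b w * centered P c w *
  centered P e w * centered P a w)); last first.
  by congr mean; apply/funext => w; ring.
ring.
Qed.

Lemma cum4_diag_lincomb {disp} {T : measurableType disp} {R : realType}
    (P : probability T R) (r : nat) (a : 'I_r -> R) (f : 'I_r -> T -> R) :
  (forall k, has_fourth_moment P (f k)) ->
  let z := fun w => \sum_k a k * f k w in
  cum4 P z z z z = \sum_k \sum_l \sum_m \sum_n
    a k * a l * a m * a n * cum4 P (f k) (f l) (f m) (f n).
Proof.
move=> hf z; have hz : has_fourth_moment P z by exact: fourth_moment_lincomb.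
rewrite cum4_lincomb //; apply: eq_bigr => k _.
(* Each rotation brings an unexpanded [z] to the front; the fourth one restores the order
   [k, l, m, n]. *)
rewrite cum4_rot cum4_lincomb // mulr_sumr; apply: eq_bigr => l _.
rewrite cum4_rot cum4_lincomb // !mulr_sumr; apply: eq_bigr => m _.
rewrite cum4_rot cum4_lincomb // !mulr_sumr; apply: eq_bigr => n _.
by rewrite cum4_rot !mulrA.
Qed.

(** The three pairings of four equal arguments coincide, whence the factor 3. *)
Lemma cum4_centered {disp} {T : measurableType disp} {R : realType}
    (P : probability T R) (z : T -> R) : mean P z = 0 ->
  cum4 P z z z z =
  mean P (fun w => z w ^+ 4) - 3 * mean P (fun w => z w * z w) ^+ 2.
Proof.
move=> z0; rewrite /cum4 centered_id //.
rewrite (_ : (fun w => z w * z w * z w * z w) = fun w => z w ^+ 4); first by ring.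
by apply/funext => w; ring.
Qed.

Lemma diag_off_cumE {disp} {T : measurableType disp} {R : realType}
    (P : probability T R) (r : nat) (s : 'rV[R]_r) (q : 'I_r -> T -> R) :
  diag_cum P s q + off_cum P s q = \sum_k \sum_l \sum_m \sum_n
    s 0 k * s 0 l * s 0 m * s 0 n * cum4 P (q k) (q l) (q m) (q n).
Proof.
rewrite /diag_cum /off_cum -big_split /=; apply: eq_bigr => k _.
pose F l m n := s 0 k * s 0 l * s 0 m * s 0 n * cum4 P (q k) (q l) (q m) (q n).
transitivity (\sum_l \sum_m \sum_(n | [&& k == l, l == m & m == n]) F l m n +
    \sum_l \sum_m \sum_(n | ~~ [&& k == l, l == m & m == n]) F l m n); last first.
  rewrite -big_split; apply: eq_bigr => l _; rewrite -big_split.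
  apply: eq_bigr => m _.
  by rewrite [RHS](bigID (fun n => [&& k == l, l == m & m == n])).
(* For fixed [k], the diagonal sum keeps only the term [l = m = n = k]. *)
congr (_ + _); rewrite (big_only1 k) // => [|l lk _]; last first.
  by rewrite big1 // => m _; rewrite big_pred0 // => n; rewrite eq_sym (negPf lk).
rewrite (big_only1 k) // => [|m mk _]; last first.
  by rewrite big_pred0 // => n; rewrite eqxx eq_sym (negPf mk).
rewrite (big_only1 k) ?eqxx // => [|n nk]; last first.
  by rewrite eq_sym (negPf nk).
by rewrite /F; ring.
Qed.

(** * The variance as a quadratic form in the singular values *)

Lemma covariance_mean0 {disp} {T : measurableType disp} {R : realType}
    (P : probability T R) (X Y : T -> R) : mean P X = 0 -> mean P Y = 0 ->
  fine (covariance P X Y) = mean P (fun w => X w * Y w).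
Proof.
rewrite /mean covariance.unlock => -> ->.
congr (fine (expectation P _)); apply/funext => w.
by rewrite !fctE /= !subr0.
Qed.

(** Bilinearity of [E[z z]]. This form lets a Loewner bound on the covariance matrix control the
    variance of [z]. *)
Lemma quad_form_mean {disp} {T : measurableType disp} {R : realType}
    (P : probability T R) (r : nat) (s : 'rV[R]_r) (f : 'I_r -> T -> R) :
  (forall k, has_fourth_moment P (f k)) -> (forall k, mean P (f k) = 0) ->
  let z := fun w => \sum_k s 0 k * f k w in
  (s *m cov_mx P f *m s^T) 0 0 = mean P (fun w => z w * z w).
Proof.
move=> hf f0 z; have hz : has_fourth_moment P z by exact: fourth_moment_lincomb.
rewrite /z mean_lincombM; last by move=> k; exact: fourth_moment_integrableM2.
rewrite mxE; apply: eq_bigr => k _; rewrite !mxE mulrC; congr (_ * _).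
rewrite (_ : (fun w => f k w * _) = fun w => (\sum_l s 0 l * f l w) * f k w);
  last by apply/funext => w; rewrite mulrC.
rewrite mean_lincombM; last by move=> l; exact: fourth_moment_integrableM2.
by apply: eq_bigr => l _; rewrite mxE covariance_mean0.
Qed.

(** * Measurability of the modes and the kurtosis bound *)

Lemma measurable_mode_prod {disp} {T : measurableType disp} {R : realType}
    (d r : nat) (x y : T -> 'cV[R]_d) (U V : 'M[R]_(d, r)) (k : 'I_r) :
  measurable_vec x -> measurable_vec y ->
  measurable_fun setT (mode_prod x y U V k).
Proof.
have proj (t : T -> 'cV[R]_d) (v : 'cV[R]_d) : measurable_vec t ->
    measurable_fun setT (fun w => ((t w)^T *m v) 0 0).
  move=> ht.
  rewrite (_ : (fun _ => _) = fun w => \sum_i t w i 0 * v i 0).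
    apply: measurable_sum => i; apply: measurable_funM => //.
  by apply/funext => w; rewrite mxE; apply: eq_bigr => i _; rewrite mxE.
by move=> hx hy; apply: measurable_funM; apply: proj.
Qed.

Theorem theorem1 (R : realType) (d dh r : nat)
    (WQ WK : 'M[R]_(d, dh)) (Rot : int -> 'M[R]_dh) (hRot : rotary Rot)
    (delta : nat)
    (disp : measure_display) (T : measurableType disp) (P : probability T R)
    (x y : T -> 'cV[R]_d) (hx : measurable_vec x) (hy : measurable_vec y)
    (U V : 'M[R]_(d, r)) (s : 'rV[R]_r)
    (hsvd : is_svd ((Num.sqrt dh%:R)^-1 *: attn_mx WQ WK Rot delta) U s V) :
  let q := mode_prod x y U V in
  let qc := fun k => centered P (q k) in
  let zc := centered_logit P s q in
  let K := cov_mx P qc in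
  forall (hmom : forall k, ('E_P[(fun w => q k w ^+ 4)%R] < +oo)%E)
    (hvar : (0 < 'V_P[zc])%E)
    (Lambda : R) (hLambda : 0 < Lambda) (hK : loewner_le K Lambda%:M)
    (hceff : 0 < c_eff P s q)
    (eta : R) (heta0 : 0 <= eta) (heta1 : eta < 1)
    (hoff : off_cum P s q >= - eta * diag_cum P s q),
  kurt P zc >= 3 + (1 - eta) * c_eff P s q / (Lambda ^+ 2 * r2 s).

Proof.
move=> q qc zc K hmom hvar Lambda hLambda hK hceff eta heta0 heta1 hoff.
have hq k : has_fourth_moment P (q k).
  have mq : measurable_fun setT (q k) by exact: measurable_mode_prod.
  split=> //; apply/integrableP; split.
    exact/measurable_EFinP/measurable_funX.
  (* A fourth power is its own absolute value, so the finite expectation is the finite integral that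
     integrability asks for. *)
  have := hmom k; rewrite unlock; congr (_ < _)%E; apply: eq_integral => w _ /=.
  by rewrite ger0_norm // (exprM _ 2 2) sqr_ge0.
have hqc k := fourth_moment_centered (hq k).
have qc0 k : mean P (qc k) = 0.
  exact/mean_centered/fourth_moment_integrable.
have hzc : has_fourth_moment P zc by exact: fourth_moment_lincomb.
have zc0 : mean P zc = 0.
  rewrite mean_lincomb => [|k]; last exact: fourth_moment_integrable.
  by rewrite big1 // => k _; rewrite qc0 mulr0.
set v := mean P (fun w => zc w * zc w).
have vE : fine ('V_P[zc])%E = v by exact: covariance_mean0.
have cumE : diag_cum P s q + off_cum P s q =
    mean P (fun w => zc w ^+ 4) - 3 * v ^+ 2.
  rewrite diag_off_cumE -cum4_centered // cum4_diag_lincomb //.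
  (* Centering twice changes nothing, so [qc] and [q] have the same cumulants. *)
  have qcE k : centered P (qc k) = qc k by exact: centered_id.
  apply: eq_bigr => k _; apply: eq_bigr => l _; apply: eq_bigr => m _.
  by apply: eq_bigr => n _; rewrite /cum4 !qcE.
have v_gt0 : 0 < v.
  (* Finiteness of the variance must be shown, since [fine] sends an infinite value to 0; it follows
     from integrability of [zc * zc]. *)
  rewrite -vE fine_gt0 // hvar /= ltey_eq; apply/orP; left.
  have := integrable_fin_num measurableT (fourth_moment_integrableM2 hzc hzc).
  rewrite /mean in zc0; rewrite /variance covariance.unlock zc0.
  rewrite expectation.unlock; congr (_ \is a fin_num).
  by apply: eq_integral => w _; rewrite !fctE /= !subr0.
set S2 := \sum_k s 0 k ^+ 2.
have vle : v <= Lambda * S2.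
  have subE (A B : 'M[R]_1) : (A - B) 0 0 = A 0 0 - B 0 0 by rewrite !mxE.
  have sE : (s *m s^T) 0 0 = S2.
    by rewrite mxE; apply: eq_bigr => k _; rewrite mxE -expr2.
  (* The Loewner bound is tested on the vector of singular values. *)
  have := hK.2 s^T; rewrite trmxK mulmxBr mulmxBl subE quad_form_mean // subr_ge0.
  by rewrite mul_mx_scalar -scalemxAl mxE sE.
set S4 := \sum_k s 0 k ^+ 4.
have S4_gt0 : 0 < S4.
  rewrite lt_def sumr_ge0 ?andbT => [|k _]; last by rewrite (exprM _ 2 2) sqr_ge0.
  (* Since [0^-1 = 0], a vanishing [S4] would make [c_eff] zero. *)
  by apply/eqP => S40; move: hceff; rewrite /c_eff -/S4 S40 invr0 mulr0 ltxx.
have D_gt0 : 0 < diag_cum P s q by move: hceff; rewrite /c_eff pmulr_lgt0 ?invr_gt0.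
have S2_gt0 : 0 < S2 by rewrite -(pmulr_rgt0 _ hLambda) (lt_le_trans v_gt0).
rewrite /kurt vE /r2 /c_eff -/S2 -/S4.
rewrite (_ : (fun w => (zc w - mean P zc) ^+ 4) = fun w => zc w ^+ 4); last first.
  by apply/funext => w; rewrite zc0 subr0.
set D := diag_cum P s q in hoff cumE D_gt0 *.
rewrite (_ : mean P _ = 3 * v ^+ 2 + (D + off_cum P s q)); last first.
  by rewrite cumE addrC subrK.
rewrite [leRHS]mulrDl mulfK ?expf_neq0 ?gt_eqF // lerD2l.
(* [S4] cancels between [c_eff] and [r2]. *)
rewrite (_ : _ / (_ * _) = (1 - eta) * D / (Lambda * S2) ^+ 2); last first.
  by field; rewrite !gt_eqF.
(* First [v <= Lambda * S2] is used with the positive numerator [(1 - eta) * D]; then [hoff] gives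
   [(1 - eta) * D <= D + off_cum P s q]. *)
apply: (@le_trans _ _ ((1 - eta) * D / v ^+ 2)).
  rewrite ler_pM2l ?mulr_gt0 ?subr_gt0 // lef_pV2 ?posrE ?exprn_gt0 ?mulr_gt0 //.
  by rewrite ler_sqr // nnegrE ltW // mulr_gt0.
by rewrite ler_pM2r ?invr_gt0 ?exprn_gt0 //; lra.
Qed.
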